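(* Let $\mathfrak{m}_1=(m_{1,n})_{n\ge0}$ and $\mathfrak{m}_2=(m_{2,n})_{n\ge0}$ be two sequences of positive real numbers with $m_{1,0}=m_{2,0}=1$. Let $P(\partial_{\mathfrak{m}_1,t},\partial_{\mathfrak{m}_2,z})=\sum_{(j,r)\in\Lambda}a_{jr}(t,z)\partial_{\mathfrak{m}_1,t}^j\partial_{\mathfrak{m}_2,z}^r$ with $\Lambda\subset\mathbb{N}_0\times\mathbb{N}_0$ finite and coefficients $a_{jr}(t,z)\in\mathcal{O}[[t]]$ (or $\mathbb{C}[[t,z]]$), and assume that $m:=\max_{(j,r)\in\Lambda}(j-\mathrm{ord}_t(a_{jr}))\ge0$. Let $l$, $\tilde P_m(n,\partial_{\mathfrak{m}_2,z})$ and $W_{m,l,\mathfrak{m}_1,\mathfrak{m}_2}$ be as in the context. Then any two of the following three conditions entail the third one: (i) The operator $P(\partial_{\mathfrak{m}_1,t},\partial_{\mathfrak{m}_2,z})\partial_{\mathfrak{m}_1,t}^{-m}$ is a linear automorphism on $\mathbb{C}[[t,z]]$. (ii) The lower ordinate of the Newton polygon $N(\tilde P_m(n,\partial_{\mathfrak{m}_2,z}))$ is equal to zero for every $n\in\mathbb{N}_0$. (iii) The non-resonance condition $W_{m,l,\mathfrak{m}_1,\mathfrak{m}_2}(n,k,0)\neq0$ holds for every $n,k\in\mathbb{N}_0$.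
   Context: $\mathbb{N}_0=\{0,1,2,\dots\}$. $\mathcal{O}[[t]]$ is the set of formal power series in $t$ whose coefficients are holomorphic functions of $z$ on some common neighborhood of the origin. For a sequence $\mathfrak{m}=(m_n)_{n\ge0}$ of positive reals, the moment derivative $\partial_{\mathfrak{m},z}$ is the linear operator $\partial_{\mathfrak{m},z}\left(\sum_{n\ge0}\frac{a_n}{m_n}z^n\right)=\sum_{n\ge0}\frac{a_{n+1}}{m_n}z^n$ on formal power series; powers are iterates. In two variables, $\partial_{\mathfrak{m}_1,t}$ acts in $t$ and $\partial_{\mathfrak{m}_2,z}$ in $z$. The operator $\partial_{\mathfrak{m}_1,t}^{-1}$ is the formal (right) inverse of $\partial_{\mathfrak{m}_1,t}$ whose images have no constant term in $t$, i.e. $\partial_{\mathfrak{m}_1,t}^{-1}t^n=\frac{m_{1,n}}{m_{1,n+1}}t^{n+1}$; $\partial_{\mathfrak{m}_1,t}^{-m}$ is its $m$-th iterate. The coefficients $a_{jr}$, $(j,r)\in\Lambda$, are nonzero ($\Lambda$ nonempty), and are written $a_{jr}(t,z)=\sum_{n\ge\mathrm{ord}_t(a_{jr})}a_{j,r,n}(z)t^n$, with $\mathrm{ord}_t$ the order of the zero in $t$ at $t=0$. Put $\Lambda_m:=\{(j,r)\in\Lambda:j-\mathrm{ord}_t(a_{jr})=m\}$; for $(j,r)\in\Lambda_m$ write $a_{j,r,j-m}(z)=z^{\alpha_{j,r}}\tilde a_{j,r,j-m}(z)$ with $\alpha_{j,r}=\mathrm{ord}_z(a_{j,r,j-m}(z))$.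 Let $l:=\min_{(j,r)\in\Lambda_m}(\alpha_{j,r}-r)$ and $\Lambda_{m,l}:=\{(j,r)\in\Lambda_m:\alpha_{j,r}-r=l\}$. For $n\in\mathbb{N}_0$, $$\tilde P_m(n,\partial_{\mathfrak{m}_2,z})=\sum_{(j,r)\in\Lambda_m,\ j\le n+m}\tilde a_{j,r,j-m}(z)z^{\alpha_{j,r}}\frac{m_{1,n}}{m_{1,n-(j-m)}}\partial_{\mathfrak{m}_2,z}^r,$$ and for $\lambda_1,\lambda_2\in\mathbb{N}_0$, $$W_{m,l,\mathfrak{m}_1,\mathfrak{m}_2}(\lambda_1,\lambda_2,z)=\sum_{(j,r)\in\Lambda_{m,l},\ j\le\lambda_1+m,\ r\le\lambda_2}\tilde a_{j,r,j-m}(z)\frac{m_{1,\lambda_1}m_{2,\lambda_2}}{m_{1,\lambda_1-(j-m)}m_{2,\lambda_2-r}}.$$ For a one-variable operator $R=\sum_{j\in\Gamma}b_j(z)\partial_{\mathfrak{m}_2,z}^j$ (terms with the same power collected, $\Gamma\subset\mathbb{N}_0$ finite, all $b_j\neq0$), the Newton polygon is $N(R)=\mathrm{conv}\{\bigcup_{j\in\Gamma}Q(j,\mathrm{ord}_z(b_j)-j)\}$, where $Q(a,b)=\{(x,y)\in\mathbb{R}^2:x\le a,\ y\ge b\}$, and its lower ordinate is $\min_{j\in\Gamma}(\mathrm{ord}_z(b_j)-j)$. (For the zero operator there is no lower ordinate, so it is not equal to any integer.) *)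

(* Defs.v *)
From HB Require Import structures.
From mathcomp Require Import all_boot all_order all_algebra finmap.
From mathcomp Require Import all_classical all_reals interval_inference convex complex.

Set Implicit Arguments.
Unset Strict Implicit.
Unset Printing Implicit Defensive.
Import Order.TTheory GRing.Theory Num.Theory.

Local Open Scope classical_set_scope.
Local Open Scope ring_scope.
Local Open Scope complex_scope.

Definition is_min d (T : porderType d) (A : set T) (x : T) :=
  A x /\ lbound A x.
Definition is_max d (T : porderType d) (A : set T) (x : T) :=
  A x /\ ubound A x.

(* The field of complex numbers is R[i], for R : realType.
   Formal power series are represented by their coefficients: f k is the
   coefficient of z^k in f : fps_z R, and u n k is the coefficient of t^n z^k
   in u : fps_tz R, so that u n : fps_z R is the coefficient of t^n in u. The
   pointwise C-vector space structure of these function types is the one of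
   C[[z]] and C[[t,z]]; their pointwise product is not used. *)
Notation fps_z R := (nat -> R[i]).
Notation fps_tz R := (nat -> nat -> R[i]).

(* Order of vanishing, used for f <> 0 only (its value is 0 for f = 0). It is
   ord_z for f : fps_z R and ord_t for f : fps_tz R. *)
Definition ord (V : nmodType) (f : nat -> V) : nat :=
  xget 0%N (is_min [set n | f n <> 0]).

Definition fps_tz_mul (R : realType) (f g : fps_tz R) : fps_tz R :=
  fun n k => \sum_(i < n.+1) \sum_(h < k.+1) f i h * g (n - i)%N (k - h)%N.

Definition zpow_mul (R : realType) (d : nat) (f : fps_z R) : fps_z R :=
  fun k => if (k < d)%N then 0 else f (k - d)%N.

(* With f_n = a_n / mu_n, the n-th coefficient a_(n+1) / mu_n of the moment
   derivative is (mu_(n+1) / mu_n) f_(n+1). *)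
Definition mderiv (R : realType) (V : lmodType R[i]) (mu : nat -> R)
    (f : nat -> V) : nat -> V :=
  fun n => (mu n.+1 / mu n)%:C *: f n.+1.

Definition mderiv_inv (R : realType) (V : lmodType R[i]) (mu : nat -> R)
    (f : nat -> V) : nat -> V :=
  fun n => if n is n'.+1 then (mu n' / mu n)%:C *: f n' else 0.

Definition dt (R : realType) (m1 : nat -> R) (u : fps_tz R) : fps_tz R :=
  mderiv m1 u.
Definition dt_inv (R : realType) (m1 : nat -> R) (u : fps_tz R) : fps_tz R :=
  mderiv_inv m1 u.
Definition dz (R : realType) (m2 : nat -> R) (u : fps_tz R) : fps_tz R :=
  fun n => mderiv m2 (u n).

Definition linear_automorphism (R : realType) (T : fps_tz R -> fps_tz R) :=
  linear T /\ bijective T.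

Section NewtonPolygon.
Variable R : realType.

(* A one-variable operator sum_j b_j(z) d^j, terms with the same power
   collected, is represented by the family b of its coefficients, and
   Gamma = {j | b_j <> 0}. *)
Implicit Type b : nat -> fps_z R.

Definition vertex_ordinate b (j : nat) : int := (ord (b j))%:Z - j%:Z.

Definition quadrant (x y : R) : set (R^o * R^o) :=
  [set p | p.1 <= x /\ y <= p.2].

Definition newton_polygon b : set (R^o * R^o) :=
  smallest (@convex_set R (R^o * R^o)%type)
    (\bigcup_(j in [set j | b j <> 0])
        quadrant j%:R (vertex_ordinate b j)%:~R).

(* A relation, because the zero operator has no lower ordinate. *)
Definition has_lower_ordinate b (y : int) :=
  is_min [set vertex_ordinate b j | j in [set j | b j <> 0]] y.

Lemma has_lower_ordinate_newton_polygon b y :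
  has_lower_ordinate b y -> is_min (snd @` newton_polygon b) (y%:~R : R).
Proof.
move=> [[j bj <-] ymin]; split.
  exists (j%:R, (vertex_ordinate b j)%:~R) => //.
  apply: sub_gen_smallest; exists j => //=; split; exact: lexx.
move=> _ [p Np <-].
suff: newton_polygon b `<=` [set q | (vertex_ordinate b j)%:~R <= q.2].
  by move=> /(_ _ Np).
apply: smallest_sub.
  move=> q1 q2 s; rewrite !inE /= => h1 h2.
  rewrite -[X in X <= _](addrNK (s%:num * (vertex_ordinate b j)%:~R)).
  rewrite addrC; apply: lerD; first by apply: ler_wpM2l.
  rewrite -{1}[(vertex_ordinate b j)%:~R]mul1r -mulrBl.
  by apply: ler_wpM2l => //; rewrite onem_ge0.
move=> q [i bi /= [_]]; apply: le_trans.
by rewrite ler_int; apply: ymin; exists i.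
Qed.

End NewtonPolygon.

Section Operator.
Variables (R : realType) (m1 m2 : nat -> R).
Variables (Lambda : {fset nat * nat}) (a : nat -> nat -> fps_tz R).

Definition op_P (u : fps_tz R) : fps_tz R :=
  \sum_(p <- Lambda)
     fps_tz_mul (a p.1 p.2) (iter p.1 (dt m1) (iter p.2 (dz m2) u)).

Definition weight (p : nat * nat) : int := p.1%:Z - (ord (a p.1 p.2))%:Z.

Variable m : nat.

Definition Lambda_m : {fset nat * nat} :=
  [fset p in Lambda | weight p == m%:Z]%fset.

(* For (j,r) in Lambda_m one has j - m = ord_t(a_jr) >= 0, so that below the
   truncated subtraction p.1 - m is exact. *)
Definition lead_coeff (p : nat * nat) : fps_z R := a p.1 p.2 (p.1 - m)%N.

Definition alpha (p : nat * nat) : nat := ord (lead_coeff p).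

Definition a_tilde (p : nat * nat) : fps_z R :=
  fun k => lead_coeff p (alpha p + k)%N.

Definition z_weight (p : nat * nat) : int := (alpha p)%:Z - p.2%:Z.

Definition P_tilde (n : nat) : nat -> fps_z R := fun r =>
  \sum_(p <- Lambda_m | (p.1 <= n + m)%N && (p.2 == r))
     (m1 n / m1 (n - (p.1 - m))%N)%:C *: zpow_mul (alpha p) (a_tilde p).

Variable l : int.

Definition Lambda_ml : {fset nat * nat} :=
  [fset p in Lambda_m | z_weight p == l]%fset.

Definition W (n k : nat) : fps_z R :=
  \sum_(p <- Lambda_ml | (p.1 <= n + m)%N && (p.2 <= k)%N)
     (m1 n * m2 k / (m1 (n - (p.1 - m))%N * m2 (k - p.2)%N))%:C *: a_tilde p.

End Operator.

(* Main.v *)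
(* As m is the maximum of j - ord_t(a_jr), the operator of (i) is triangular for
   the filtration of C[[t,z]] by powers of t, with the operator \tilde P_m(n) on
   C[[z]] as its n-th diagonal block. Each pair of conditions forces l = 0. For
   l = 0 each block is in turn triangular for powers of z, with diagonal entries
   W(n,k,0), k >= 0. An automorphism that is triangular with infinite-dimensional
   blocks need not have invertible blocks in general; here it does, by induction
   on n, because a surjective triangular operator on C[[z]] has nonzero diagonal
   entries and is therefore injective. *)
Require Import Defs.
From HB Require Import structures.
From mathcomp Require Import all_boot all_order all_algebra finmap zify ring.
From mathcomp Require Import all_classical all_reals convex complex.

Set Implicit Arguments.
Unset Strict Implicit.

Import Order.TTheory GRing.Theory Num.Theory.
Local Open Scope classical_set_scope.
Local Open Scope ring_scope.

(** * Triangular operators on sequences with entries in an abelian group *)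

Section Causal.
Variables (V : zmodType) (T : (nat -> V) -> nat -> V).

Definition causal :=
  forall u n, (forall i, (i <= n)%N -> u i = 0) -> T u n = 0.

Definition single (n : nat) (x : V) : nat -> V :=
  fun i => if i == n then x else 0.

Definition diag (n : nat) (x : V) : V := T (single n x) n.

Hypotheses (T_morph : zmod_morphism T) (T_causal : causal).

Lemma causal_eq u v n : (forall i, (i <= n)%N -> u i = v i) -> T u n = T v n.
Proof.
move=> uv; apply/eqP; rewrite -subr_eq0; apply/eqP.
transitivity (T (u - v) n); first by rewrite T_morph.
by apply: T_causal => i /uv uvi; apply/eqP; rewrite subr_eq0; apply/eqP.
Qed.

Lemma causal_diagE u n :
  (forall i, (i < n)%N -> u i = 0) -> T u n = diag n (u n).
Proof.
move=> u0; apply: causal_eq => i; rewrite leq_eqVlt /single.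
by case: eqP => [->//|_ /= /u0].
Qed.

(** Forward substitution: once the entries below [n] are known to vanish, entry [n] is killed by the
    [n]-th diagonal block alone. *)
Lemma causal_inj : (forall n x, diag n x = 0 -> x = 0) -> injective T.
Proof.
move=> dinj u v Tuv; apply/funext => n.
apply/eqP; rewrite -subr_eq0; apply/eqP.
have Tw0 i : T (u - v) i = 0 by rewrite T_morph Tuv subrr.
change ((u - v) n = 0); move: (u - v) Tw0 => w Tw0.
elim/ltn_ind: n => n IH.
by apply: (dinj n); rewrite -causal_diagE.
Qed.

Lemma causal_surj : (forall n y, exists x, diag n x = y) ->
  forall g, exists u, T u = g.
Proof.
move=> dsurj g.
have /choice[s sP] : forall ny : nat * V, exists x, diag ny.1 x = ny.2.
  by move=> [n y]; apply: dsurj.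
(* [U n] solves the equation at the indices below [n]; the next entry is a preimage under [diag n]
   of the residual at [n]. *)
pose U := fix U n := if n is n'.+1
  then U n' + single n' (s (n', g n' - T (U n') n')) else 0.
have US n : U n.+1 = U n + single n (s (n, g n - T (U n) n)) by [].
have Ustable n i : (i < n)%N -> U n i = U i.+1 i.
  elim: n => // n IH; rewrite ltnS leq_eqVlt => /predU1P[->//|ltin].
  rewrite -IH // US; change (U n i + single n (s (n, g n - T (U n) n)) i = U n i).
  by rewrite /single ltn_eqF // addr0.
exists (fun n => U n.+1 n); apply/funext => n.
have -> : T (fun n => U n.+1 n) n = T (U n.+1) n.
  by apply: causal_eq => i lein; rewrite Ustable.
have TD v w : T (v + w) = T v + T w.
  by apply/eqP; rewrite -subr_eq -T_morph addrK.
rewrite US TD; change (T (U n) n + diag n (s (n, g n - T (U n) n)) = g n).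
by have /= -> := sP (n, g n - T (U n) n); rewrite addrC subrK.
Qed.

(** Solve [T u = single n y]. The blocks before [n] are onto by induction, hence injective, so they
    force [u] to vanish below [n], and [u n] is a preimage of [y]. *)
Lemma causal_diag_surj : (forall g, exists u, T u = g) ->
    (forall n, (forall y, exists x, diag n x = y) ->
      forall x, diag n x = 0 -> x = 0) ->
  forall n y, exists x, diag n x = y.
Proof.
move=> Tsurj dinj; elim/ltn_ind => n IH y.
have [u Tu] := Tsurj (single n y).
have u0 i : (i < n)%N -> u i = 0.
  elim/ltn_ind: i => i IHi ltin; apply: (dinj i (IH i ltin)).
  rewrite -causal_diagE => [|j ltji]; last exact/IHi/(ltn_trans ltji).
  by rewrite Tu /single ltn_eqF.
by exists (u n); rewrite -causal_diagE // Tu /single eqxx.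
Qed.

End Causal.

(** * Orders of vanishing, iterated moment derivatives, lower ordinates *)

Lemma ord_lt (V : nmodType) (f : nat -> V) i : (i < ord f)%N -> f i = 0.
Proof.
rewrite /ord; case: xgetP => [_ -> [_ min_f]|//].
by move=> lti; apply/eqP/negPn/negP => /eqP /min_f; rewrite leEnat leqNgt lti.
Qed.

Lemma ord_neq0 (V : nmodType) (f : nat -> V) : f <> 0 -> f (ord f) <> 0.
Proof.
move=> f0; rewrite /ord; case: xgetP => [_ -> [] //|nomin].
have exf : exists n, f n != 0.
  by apply/not_existsP => f_0; apply: f0; apply/funext => n;
     apply/eqP/negPn/negP/f_0.
have [n fn nmin] := ex_minnP exf.
by case: (nomin n); split=> [|k /eqP /nmin//]; apply/eqP.
Qed.

Lemma ord_le (V : nmodType) (f : nat -> V) i : f i <> 0 -> (ord f <= i)%N.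
Proof. by move=> fi; rewrite leqNgt; apply/negP => /ord_lt. Qed.

Section Coefficients.
Variables (R : realType) (V : lmodType R[i]) (mu : nat -> R).
Hypothesis mu_gt0 : forall n, 0 < mu n.

(** The quotients of consecutive moments telescope. *)
Lemma iter_mderiv j (f : nat -> V) n :
  iter j (mderiv mu) f n = (mu (n + j)%N / mu n)%:C%C *: f (n + j)%N.
Proof.
elim: j n => [|j IH] n /=.
  by rewrite addn0 divff ?gt_eqF // scale1r.
rewrite {1}/mderiv IH scalerA -rmorphM addSnnS.
by congr ((_ )%:C%C *: _); rewrite mulrC mulrA divfK ?gt_eqF.
Qed.

Lemma iter_mderiv_inv j (f : nat -> V) n :
  iter j (mderiv_inv mu) f n =
  if (n < j)%N then 0 else (mu (n - j)%N / mu n)%:C%C *: f (n - j)%N.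
Proof.
elim: j n => [|j IH] n /=.
  by rewrite subn0 divff ?gt_eqF // scale1r.
case: n => [//|n] /=; rewrite IH ltnS; case: ltnP => _; first by rewrite scaler0.
rewrite scalerA -rmorphM subSS.
by congr ((_ )%:C%C *: _); rewrite mulrC mulrA divfK ?gt_eqF.
Qed.

End Coefficients.

(** Trades orders for single coefficients: the one of z^k in [b r] sits at height k - r, and [ord]
    picks the lowest nonzero one for each r. *)
Lemma has_lower_ordinateP (R : realType) (b : nat -> fps_z R) (y : int) :
  has_lower_ordinate b y <->
  (exists r k, b r k <> 0 /\ k%:Z - r%:Z = y) /\
  (forall r k, b r k <> 0 -> y <= k%:Z - r%:Z).
Proof.
have b_neq0 r k : b r k <> 0 -> b r <> 0 by move=> brk br; rewrite br in brk.
split=> [[[r br <-] ymin]|[[r [k [brk <-]]] ymin]]; split.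
- by exists r, (ord (b r)); split=> //; apply: ord_neq0.
- move=> s k bsk; apply: (@le_trans _ _ (vertex_ordinate b s)).
    by apply: ymin; exists s => //; apply: b_neq0 bsk.
  by rewrite lerD2r lez_nat ord_le.
- exists r; first exact: b_neq0 brk.
  apply/eqP; rewrite eq_le lerD2r lez_nat ord_le //=.
  by apply/ymin/ord_neq0/b_neq0/brk.
- by move=> _ [s bs <-]; apply/ymin/ord_neq0.
Qed.

(** * The operator of (i) and its diagonal blocks in t *)

Section Operator.
Variables (R : realType) (m1 m2 : nat -> R).
Hypotheses (m1_gt0 : forall n, 0 < m1 n) (m2_gt0 : forall n, 0 < m2 n).
Variables (Lambda : {fset nat * nat}) (a : nat -> nat -> fps_tz R) (m : nat).
Hypothesis a_neq0 : forall j r, (j, r) \in Lambda -> a j r <> 0.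
Hypothesis m_max : ubound [set weight a p | p in [set` Lambda]] m%:Z.

Let op (u : fps_tz R) := op_P m1 m2 Lambda a (iter m (dt_inv m1) u).

(** The moments at [n - i + p.1] cancel between the derivatives and their inverses; the zero branch
    is where the m-fold inverse has no coefficient. *)
Lemma opE u n k : op u n k =
  \sum_(p <- Lambda) \sum_(i < n.+1) \sum_(h < k.+1)
     a p.1 p.2 i h *
     (if (n - i + p.1 < m)%N then 0 else
       (m1 (n - i + p.1 - m) / m1 (n - i) *
         (m2 (k - h + p.2) / m2 (k - h)))%:C%C *
       u (n - i + p.1 - m)%N (k - h + p.2)%N).
Proof.
have dtE j (v : fps_tz R) i h :
    iter j (dt m1) v i h = (m1 (i + j)%N / m1 i)%:C%C * v (i + j)%N h.
  by rewrite [iter j _ v i](iter_mderiv m1_gt0).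
have dzE r (v : fps_tz R) i h :
    iter r (dz m2) v i h = (m2 (h + r)%N / m2 h)%:C%C * v i (h + r)%N.
  rewrite (_ : iter r (dz m2) v i = iter r (mderiv m2) (v i)).
    exact: (@iter_mderiv R R[i] _ m2_gt0).
  by elim: r => //= r IH; rewrite /dz IH.
have dt_invE j (v : fps_tz R) i h : iter j (dt_inv m1) v i h =
    if (i < j)%N then 0 else (m1 (i - j)%N / m1 i)%:C%C * v (i - j)%N h.
  by rewrite [iter j _ v i](iter_mderiv_inv m1_gt0); case: ifP.
rewrite /op /op_P !fct_sumE; apply: eq_bigr => p _.
rewrite /fps_tz_mul; apply: eq_bigr => i _; apply: eq_bigr => h _.
rewrite dtE dzE dt_invE; congr (_ * _); case: ifP => _; first by rewrite !mulr0.
rewrite !mulrA -!rmorphM /=; congr (_%:C%C * _).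
by field; rewrite !gt_eqF.
Qed.

Lemma op_linear : linear op.
Proof.
move=> c u v; apply/funext => n; apply/funext => k.
change (op (c *: u + v) n k = c * op u n k + op v n k).
rewrite !opE mulr_sumr -big_split; apply: eq_bigr => p _ /=.
rewrite mulr_sumr -big_split; apply: eq_bigr => i _ /=.
rewrite mulr_sumr -big_split; apply: eq_bigr => h _ /=.
case: ifP => _; first by rewrite !mulr0 addr0.
rewrite [(c *: u + v) _ _](_ : _ = c * u (n - i + p.1 - m)%N (k - h + p.2)%N
  + v (n - i + p.1 - m)%N (k - h + p.2)%N) //.
by ring.
Qed.

Lemma op_zmod_morphism : zmod_morphism op.
Proof. by apply: zmod_morphism_linear; apply: op_linear. Qed.

Lemma coeff_eq0 (p : nat * nat) i :
  p \in Lambda -> (i + m < p.1)%N -> a p.1 p.2 i = 0.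
Proof.
move=> pL ltip; apply: ord_lt.
have : weight a p <= m%:Z by apply: m_max; exists p.
by rewrite /weight /=; lia.
Qed.

(** The coefficient of t^i in a_jr multiplies entry n - i + j - m of [u]. This index exceeds n only
    when i < j - m, where [coeff_eq0] applies. *)
Lemma op_causal : causal op.
Proof.
move=> u n u0; apply/funext => k; rewrite opE big_seq big1 // => -[j r] jrL.
rewrite big1 // => i _; rewrite big1 // => h _ /=.
case: (ltnP (i + m)%N j) => [ltip|leip];
  first by rewrite (coeff_eq0 jrL) // mul0r.
case: ifP => _; first by rewrite mulr0.
by rewrite u0 ?mulr0 //; have := ltn_ord i; lia.
Qed.

Lemma Lambda_mP (p : nat * nat) :
  p \in Lambda_m Lambda a m -> (p \in Lambda) && (weight a p == m%:Z).
Proof. by rewrite !inE. Qed.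

(** Entry n is read only through i = j - m, and the coefficient of t^(j-m) in a_jr is nonzero only
    on [Lambda_m]. The result is the action of \tilde P_m(n). *)
Lemma op_diagE n f k : diag op n f k =
  \sum_(p <- Lambda_m Lambda a m | (p.1 <= n + m)%N)
    (m1 n / m1 (n - (p.1 - m))%N)%:C%C *
    \sum_(h < k.+1) lead_coeff a m p h *
      ((m2 (k - h + p.2) / m2 (k - h))%:C%C * f (k - h + p.2)%N).
Proof.
rewrite /diag opE [RHS]big_mkcond /Lambda_m big_fset [RHS]big_mkcond /=.
apply: eq_big_seq => -[j r] pL /=.
have offdiag (i : 'I_n.+1) : (j != i + m)%N ->
  \sum_(h < k.+1) a j r i h *
     (if (n - i + j < m)%N then 0 else
       (m1 (n - i + j - m) / m1 (n - i) *
         (m2 (k - h + r) / m2 (k - h)))%:C%C *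
       single n f (n - i + j - m)%N (k - h + r)%N) = 0.
  move=> neq; rewrite big1 // => h _.
  case: (ltnP (i + m)%N j) => [ltip|leip];
  first by rewrite (coeff_eq0 pL) // mul0r.
  case: ifP => [_|/negbT]; first by rewrite mulr0.
  rewrite -leqNgt => lem; rewrite /single ifF ?mulr0 //.
  by apply/negbTE; have := ltn_ord i; lia.
have [/andP[le1 le2]|/negP nle] := boolP ((m <= j)%N && (j <= n + m)%N);
  last first.
  (* Here j - m is not an index between 0 and n; on the right, weight m would force m <= j. *)
  rewrite big1 => [|i _]; last first.
    by apply: offdiag; have := ltn_ord i; lia.
  case: eqP => // wp; case: ifP => // le2; case: nle; rewrite le2 andbT.
  by move: wp; rewrite /weight /=; lia.
have lt0 : (j - m < n.+1)%N by lia.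
rewrite (bigD1 (Ordinal lt0)) //= [X in _ + X]big1 => [|i neq]; last first.
  by apply: offdiag; move: neq; rewrite -val_eqE /=; lia.
rewrite addr0 le2; case: eqP => wp.
  rewrite mulr_sumr; apply: eq_bigr => h _.
  rewrite ifF; last by lia.
  rewrite (_ : n - (j - m) + j - m = n)%N; last by lia.
  rewrite /single eqxx rmorphM /lead_coeff /=; ring.
(* Outside [Lambda_m] the weight is below m, so ord_t(a_jr) > j - m. *)
suff a0 : a j r (j - m)%N = 0 by rewrite big1 // => h _; rewrite a0 mul0r.
apply: ord_lt; have : weight a (j, r) <= m%:Z by apply: m_max; exists (j, r).
by move: wp; rewrite /weight /=; lia.
Qed.

Lemma op_diag_zmod_morphism n : zmod_morphism (diag op n).
Proof.
move=> f g; rewrite /diag.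
rewrite (_ : single n (f - g) = single n f - single n g).
  by rewrite op_zmod_morphism.
apply/funext => i; change (single n (f - g) i =
  single n f i - single n g i).
by rewrite /single; case: eqP => _ //; rewrite subr0.
Qed.

(** * The minimal z-weight and the lower ordinate *)

Variable l : int.
Hypothesis l_min :
  is_min [set z_weight a m p | p in [set` Lambda_m Lambda a m]] l.

Lemma lead_coeff_lt (p : nat * nat) h :
  h%:Z - p.2%:Z < z_weight a m p -> lead_coeff a m p h = 0.
Proof.
by move=> lth; apply: ord_lt; move: lth; rewrite ltrD2r ltz_nat.
Qed.

Lemma lead_coeff_eq0 (p : nat * nat) h : p \in Lambda_m Lambda a m ->
  h%:Z - p.2%:Z < l -> lead_coeff a m p h = 0.
Proof.
move=> pL lth; apply: lead_coeff_lt; apply: lt_le_trans lth _.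
by apply: l_min.2; exists p.
Qed.

Lemma P_tildeE n r k : P_tilde m1 Lambda a m n r k =
  \sum_(p <- Lambda_m Lambda a m | (p.1 <= n + m)%N && (p.2 == r))
    (m1 n / m1 (n - (p.1 - m))%N)%:C%C * lead_coeff a m p k.
Proof.
rewrite /P_tilde fct_sumE; apply: eq_bigr => p _.
set c := _%:C%C; change (c * zpow_mul (alpha a m p) (a_tilde a m p) k =
  c * lead_coeff a m p k).
congr (_ * _); rewrite /zpow_mul /a_tilde; case: ltnP => [lt|le].
  by rewrite ord_lt.
by rewrite subnKC.
Qed.

(** Indexing by [Lambda_m] allows a termwise comparison with [P_tildeE] and [op_diagE]. *)
Lemma WE n k : W m1 m2 Lambda a m l n k 0%N =
  \sum_(p <- Lambda_m Lambda a m | (p.1 <= n + m)%N && (p.2 <= k)%N)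
    (m1 n / m1 (n - (p.1 - m))%N)%:C%C *
    ((m2 k / m2 (k - p.2)%N)%:C%C *
      (if z_weight a m p == l
       then lead_coeff a m p (alpha a m p) else 0)).
Proof.
rewrite /W fct_sumE [LHS]big_mkcond /Lambda_ml big_fset.
rewrite -big_mkcondr [RHS]big_mkcond [LHS]big_mkcond; apply: eq_bigr => p _.
case: eqP => _; case: ((p.1 <= n + m)%N && (p.2 <= k)%N) => //=;
  last by rewrite !mulr0.
set c := _%:C%C; change (c * a_tilde a m p 0%N =
  (m1 n / m1 (n - (p.1 - m)))%:C%C *
  ((m2 k / m2 (k - p.2))%:C%C * lead_coeff a m p (alpha a m p))).
rewrite /a_tilde addn0 mulrA -rmorphM; congr (_%:C%C * _) => /=.
by field; rewrite !gt_eqF.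
Qed.

Lemma P_tilde_eq0 n r k :
  k%:Z - r%:Z < l -> P_tilde m1 Lambda a m n r k = 0.
Proof.
move=> ltk; rewrite P_tildeE big_seq_cond big1 // => p /and3P[pL _ /eqP pr].
by rewrite lead_coeff_eq0 ?mulr0 // pr.
Qed.

(* At degree 0 in z, only the terms with r = 0 contribute to W. *)
Lemma W0_lower_ordinate n : W m1 m2 Lambda a m l n 0 0%N <> 0 ->
  0 <= l /\ has_lower_ordinate (P_tilde m1 Lambda a m n) l.
Proof.
move=> W0.
have l_ge0 : 0 <= l.
  rewrite leNgt; apply/negP => l_lt0; apply: W0; rewrite WE big1 // => p.
  move=> /andP[_]; rewrite leqn0 => /eqP p0.
  by rewrite ifF ?mulr0 //; apply/eqP; rewrite /z_weight p0; lia.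
split=> //; apply/has_lower_ordinateP; split; last first.
  by move=> r k Prk; rewrite leNgt; apply/negP => /P_tilde_eq0.
have [d ld] : exists d : nat, l = d%:Z by exists `|l|%N; lia.
(* The coefficient of z^l in the order-zero part of the operator is exactly W(n,0,0). *)
exists 0%N, d; split; last by rewrite ld; lia.
move=> P0; apply: W0; rewrite -{}P0 WE P_tildeE.
under eq_bigl do rewrite leqn0.
rewrite [LHS]big_seq_cond [RHS]big_seq_cond.
apply: eq_bigr => p /and3P[pL _ /eqP p0].
rewrite p0 subn0 divff; last by rewrite gt_eqF.
rewrite (rmorph1 (real_complex R)) mul1r; congr (_ * _).
have : l <= z_weight a m p by apply: l_min.2; exists p.
rewrite /z_weight p0 subr0 ld eqz_nat; case: eqP => [->//|neq] le.
by rewrite [RHS]ord_lt // -/(alpha a m p); lia.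
Qed.

Lemma P_tilde_lower_ordinate :
  (forall n, has_lower_ordinate (P_tilde m1 Lambda a m n) 0) -> l = 0.
Proof.
move=> ii.
have lowP n := (has_lower_ordinateP _ _).1 (ii n).
apply/eqP; rewrite eq_le; apply/andP; split.
  have [[r [k [Prk <-]]] _] := lowP 0%N.
  by rewrite leNgt; apply/negP => /(P_tilde_eq0 0).
(* For the least j with alpha_jr - r = l, no other term of the operator
   \tilde P_m(j - m) can cancel the term (j,r) at z^alpha_jr. *)
pose Q j := `[< exists p, [/\ p \in Lambda_m Lambda a m,
                             z_weight a m p = l & p.1 = j] >].
have exQ : exists j, Q j.
  by have [p pL pl] := l_min.1; exists p.1; apply/asboolP; exists p.
have [_ /asboolP[[j r] [pL pl <-]] jmin] := ex_minnP exQ.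
rewrite /= in jmin.
have [pL0 /eqP] := andP (Lambda_mP pL); rewrite /weight /= => wp.
have [lejm ordE] : (m <= j)%N /\ ord (a j r) = (j - m)%N by lia.
have [_ low] := lowP (j - m)%N.
rewrite -pl; apply: low; rewrite P_tildeE -big_filter.
rewrite (@bigD1_seq _ _ _ _ _ (j, r)) ?filter_uniq ?fset_uniq //=; last first.
  by rewrite mem_filter pL eqxx andbT /=; lia.
rewrite big_seq_cond big1 => [|[j' r'] /andP[]]; last first.
  rewrite mem_filter => /= /andP[/andP[le1 /eqP ->]] qL neq {r'}.
  have lt1 : (j' < j)%N.
    rewrite ltn_neqAle; apply/andP; split; last by lia.
    by apply: contra_neq neq => ->.
  have : l <= z_weight a m (j', r) by apply: l_min.2; exists (j', r).
  have zq : z_weight a m (j', r) <> l.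
    move=> zq; have : Q j' by apply/asboolP; exists (j', r).
    by move=> /jmin; rewrite leqNgt lt1.
  move=> le; rewrite lead_coeff_lt ?mulr0 //.
  change (z_weight a m (j, r) < z_weight a m (j', r)).
  by rewrite pl lt_neqAle le andbT eq_sym; apply/eqP.
rewrite addr0; apply/eqP/mulf_neq0.
  by rewrite fmorph_eq0 mulf_neq0 ?invr_eq0 ?gt_eqF.
by apply/eqP/ord_neq0; rewrite /lead_coeff /= -ordE; apply/ord_neq0/a_neq0.
Qed.

(** Obstruction to surjectivity: a constant term of the image could only come from coefficients at
    heights -r <= 0 < l. *)
Lemma op_diag_coeff0 n f : 0 < l -> diag op n f 0 = 0.
Proof.
move=> l_gt0; rewrite op_diagE big_seq_cond big1 // => p /andP[pL _].
by rewrite big_ord1 lead_coeff_eq0 ?mul0r ?mulr0 //=; lia.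
Qed.

(** * The case l = 0: the blocks are triangular in z *)

Section Critical.
Hypothesis l_eq0 : l = 0.

(** Since l = 0, z^h occurs with the r-th derivative only for h >= r, so only entries k - h + r <= k
    are read. *)
Lemma op_diag_causal n : causal (diag op n).
Proof.
move=> f k f0; rewrite op_diagE big_seq_cond big1 // => -[j r] /andP[pL _].
rewrite big1 ?mulr0 // => h _ /=; case: (ltnP h r) => [lt|le].
  by rewrite lead_coeff_eq0 ?mul0r //=; lia.
by rewrite f0 ?mulr0 //; have := ltn_ord h; lia.
Qed.

(** Entry k is read only through h = r, and the coefficient of z^r survives only if alpha = r, that
    is, if the z-weight equals l. *)
Lemma op_diag_diagE n k c :
  diag (diag op n) k c = W m1 m2 Lambda a m l n k 0%N * c.
Proof.
rewrite [LHS]op_diagE WE mulr_suml [RHS]big_mkcond [LHS]big_mkcond.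
apply: eq_big_seq => -[j r] pL /=; case: (leqP j _) => //= _.
have offdiag (h : 'I_k.+1) : (h : nat) != r -> lead_coeff a m (j, r) h *
    ((m2 (k - h + r) / m2 (k - h))%:C%C * single k c (k - h + r)%N) = 0.
  move=> neq; rewrite /single ifF ?mulr0 //.
  by have := ltn_ord h; lia.
case: leqP => [le|lt]; last first.
  rewrite big1 ?mulr0 // => h _; apply: offdiag.
  by have := ltn_ord h; lia.
rewrite (bigD1 (Ordinal (le : (r < k.+1)%N))) //= [X in _ + X]big1; last first.
  by move=> h; rewrite -val_eqE => /offdiag.
rewrite addr0 subnK // /single eqxx -!mulrA; congr (_ * _).
rewrite mulrCA; congr (_ * (_ * _)).
have lez : l <= z_weight a m (j, r) by apply: l_min.2; exists (j, r).
case: eqP => [zl|/eqP neq]; last first.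
  by rewrite lead_coeff_lt //= subrr -l_eq0 lt_neqAle eq_sym neq.
have -> // : alpha a m (j, r) = r.
by move/eqP: zl; rewrite l_eq0 subr_eq0 eqz_nat => /eqP.
Qed.

Lemma op_diag_surj_W n : (forall g, exists f, diag op n f = g) ->
  forall k, W m1 m2 Lambda a m l n k 0%N <> 0.
Proof.
move=> surj k.
(* The diagonal entries are scalars: an onto one is nonzero, hence injective, as [causal_diag_surj]
   requires. *)
have Wc_surj j : (forall y, exists x, diag (diag op n) j x = y) ->
    W m1 m2 Lambda a m l n j 0%N <> 0.
  move=> /(_ 1)[x]; rewrite op_diag_diagE => + Wj.
  by rewrite Wj mul0r => /esym/eqP; rewrite oner_eq0.
apply: (Wc_surj k); apply: causal_diag_surj surj _ k.
- exact: op_diag_zmod_morphism.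
- exact: op_diag_causal.
move=> j /Wc_surj Wj x /eqP.
by rewrite op_diag_diagE mulf_eq0 => /predU1P[/Wj|/eqP].
Qed.

Lemma W_op_diag_inj n : (forall k, W m1 m2 Lambda a m l n k 0%N <> 0) ->
  forall f, diag op n f = 0 -> f = 0.
Proof.
move=> Wn f f0.
have d0 : diag op n 0 = 0.
  by rewrite -[0 in LHS]subr0 op_diag_zmod_morphism subrr.
apply: (@causal_inj _ (diag op n)); rewrite ?f0 //.
- exact: op_diag_zmod_morphism.
- exact: op_diag_causal.
by move=> k x /eqP; rewrite op_diag_diagE mulf_eq0 => /predU1P[/Wn|/eqP].
Qed.

Lemma W_op_diag_surj n : (forall k, W m1 m2 Lambda a m l n k 0%N <> 0) ->
  forall g, exists f, diag op n f = g.
Proof.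
move=> Wn; apply: causal_surj.
- exact: op_diag_zmod_morphism.
- exact: op_diag_causal.
move=> k y; exists (y / W m1 m2 Lambda a m l n k 0%N).
by rewrite op_diag_diagE mulrC divfK //; apply/eqP.
Qed.

End Critical.
End Operator.

(** * The three implications between the conditions *)

Theorem corollary4 (R : realType) (m1 m2 : nat -> R)
    (m1_gt0 : forall n, 0 < m1 n) (m2_gt0 : forall n, 0 < m2 n)
    (m1_0 : m1 0%N = 1) (m2_0 : m2 0%N = 1)
    (Lambda : {fset nat * nat}) (Lambda_neq0 : Lambda <> fset0)
    (a : nat -> nat -> fps_tz R)
    (a_neq0 : forall j r, (j, r) \in Lambda -> a j r <> 0)
    (m : nat)
    (m_max : is_max [set weight a p | p in [set` Lambda]] m%:Z)
    (l : int)
    (l_min : is_min [set z_weight a m p | p in [set` Lambda_m Lambda a m]] l) :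
  let cond_i :=
    linear_automorphism
      (fun u => op_P m1 m2 Lambda a (iter m (dt_inv m1) u)) in
  let cond_ii :=
    forall n : nat, has_lower_ordinate (P_tilde m1 Lambda a m n) 0 in
  let cond_iii :=
    (* evaluation at z = 0 is the coefficient of index 0 *)
    forall n k : nat, W m1 m2 Lambda a m l n k 0%N <> 0 in
  [/\ cond_i -> cond_ii -> cond_iii,
      cond_i -> cond_iii -> cond_ii &
      cond_ii -> cond_iii -> cond_i].
Proof.
move=> cond_i cond_ii cond_iii.
pose op u := op_P m1 m2 Lambda a (iter m (dt_inv m1) u).
have op_add : zmod_morphism op by exact: op_zmod_morphism.
have op_tri : causal op by apply: op_causal m_max.2.
have i_surj : cond_i -> forall g, exists u, op u = g.
  by move=> [_ [h _ hK]] g; exists (h g); apply: hK.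
have iii_low (iii : cond_iii) n : 0 <= l /\ _ :=
  W0_lower_ordinate m1_gt0 m2_gt0 l_min (iii n 0%N).
split.
- move=> /i_surj surj ii n.
  have l0 := P_tilde_lower_ordinate m1_gt0 a_neq0 l_min ii.
  apply: (op_diag_surj_W m1_gt0 m2_gt0 m_max.2 l_min l0).
  (* A block that is onto has nonzero entries W, so it is injective; the induction over powers of t
     then makes every block onto. *)
  apply: causal_diag_surj op_add op_tri surj _ n => n dsurj.
  apply: (W_op_diag_inj m1_gt0 m2_gt0 m_max.2 l_min l0).
  exact: (op_diag_surj_W m1_gt0 m2_gt0 m_max.2 l_min l0 dsurj).
- move=> /i_surj surj iii.
  have [l_ge0 _] := iii_low iii 0%N.
  suff l0 : l = 0 by move=> n; have [_] := iii_low iii n; rewrite l0.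
  apply/eqP; rewrite eq_le l_ge0 andbT leNgt; apply/negP => l_gt0.
  (* If l > 0, block 0 would annihilate the constant term, which is 1 in this target. *)
  have [u uE] := surj (fun _ _ => 1).
  have := op_diag_coeff0 m1_gt0 m2_gt0 m_max.2 l_min 0 (u 0%N) l_gt0.
  rewrite -[diag _ _ _](@causal_diagE _ op op_add op_tri) // uE.
  by move/eqP; rewrite oner_eq0.
move=> ii iii.
have l0 := P_tilde_lower_ordinate m1_gt0 a_neq0 l_min ii.
split; first exact: op_linear.
(* Forward substitution twice: in z inside each block, then in t across the blocks. *)
have op_inj : injective op.
  apply: causal_inj => // n.
  exact: (W_op_diag_inj m1_gt0 m2_gt0 m_max.2 l_min l0 (iii n)).
have /choice[h hK] : forall g, exists u, op u = g.
  apply: causal_surj => // n.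
  exact: (W_op_diag_surj m1_gt0 m2_gt0 m_max.2 l_min l0 (iii n)).
by exists h => [u|//]; apply: op_inj; rewrite hK.
Qed.
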